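(* Let $\mathbb{C}$ be a regular category and let $X$ be an object of $\mathbb{C}$ with global support. If $X$ is regularly-coextensive, then $X$ is projection-coextensive.
   Context: A category is regular if it has finite limits, coequalizers of kernel pairs, and regular epimorphisms are stable under pullback. $X$ has global support if $X\to 1$ is a regular epimorphism. A product projection of $X$ is a morphism $X\to A$ that is one of the two legs of some binary product diagram $A\leftarrow X\to A'$. For a class $\mathcal{M}$ of morphisms, an $\mathcal{M}$-pushout is a pushout square whose two morphisms into the pushout object belong to $\mathcal{M}$. $X$ is $\mathcal{M}$-coextensive if every morphism in $\mathcal{M}$ with domain $X$ admits an $\mathcal{M}$-pushout along every product projection of $X$, and for every commutative diagram consisting of a product diagram $A_1\leftarrow X\to A_2$ (top row), a bottom row $B_1\leftarrow Y\to B_2$, and vertical morphisms $A_1\to B_1$, $X\to Y$, $A_2\to B_2$ all in $\mathcal{M}$, the bottom row is a product diagram if and only if both squares are $\mathcal{M}$-pushouts. $X$ is regularly-coextensive (respectively projection-coextensive) if it is $\mathcal{M}$-coextensive with $\mathcal{M}$ the class of all regular epimorphisms (respectively all product projections) in $\mathbb{C}$. *)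

(* Defs.v *)
From Stdlib Require Import FinFun.

Set Implicit Arguments.
Unset Strict Implicit.
Unset Printing Implicit Defensive.

Declare Scope cat_scope.
Delimit Scope cat_scope with cat.
Local Open Scope cat_scope.

Record Category : Type := MkCategory {
  Obj :> Type;
  Hom : Obj -> Obj -> Type;
  idm : forall X, Hom X X;
  comp : forall X Y Z, Hom Y Z -> Hom X Y -> Hom X Z;
  comp_idl : forall X Y (f : Hom X Y), comp (idm Y) f = f;
  comp_idr : forall X Y (f : Hom X Y), comp f (idm X) = f;
  comp_assoc : forall X Y Z W (h : Hom Z W) (g : Hom Y Z) (f : Hom X Y),
    comp h (comp g f) = comp (comp h g) f
}.
Arguments Hom {c} X Y.
Arguments idm {c} X.
Arguments comp {c X Y Z} g f.

Notation "g ∘ f" := (comp g f) (at level 40, left associativity) : cat_scope.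

Record Functor (J C : Category) : Type := MkFunctor {
  fobj :> J -> C;
  fmap : forall i j : J, Hom i j -> Hom (fobj i) (fobj j);
  fmap_id : forall i : J, fmap (idm i) = idm (fobj i);
  fmap_comp : forall (i j k : J) (v : Hom j k) (u : Hom i j),
    fmap (v ∘ u) = fmap v ∘ fmap u
}.

Definition is_cone (J C : Category) (F : Functor J C) (L : C)
    (pi : forall i : J, Hom L (F i)) : Prop :=
  forall (i j : J) (u : Hom i j), fmap F u ∘ pi i = pi j.

Definition is_limit (J C : Category) (F : Functor J C) (L : C)
    (pi : forall i : J, Hom L (F i)) : Prop :=
  is_cone pi /\
  forall (Z : C) (z : forall i : J, Hom Z (F i)), is_cone z ->
    exists! h : Hom Z L, forall i : J, pi i ∘ h = z i.

Definition finite_category (J : Category) : Prop :=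
  Finite J /\ forall i j : J, Finite (Hom i j).

Definition has_finite_limits (C : Category) : Prop :=
  forall (J : Category) (F : Functor J C), finite_category J ->
    exists (L : C) (pi : forall i : J, Hom L (F i)), is_limit pi.

Definition is_terminal (C : Category) (T : C) : Prop :=
  forall Z : C, exists! t : Hom Z T, True.

Definition is_product (C : Category) (A P A' : C)
    (p : Hom P A) (p' : Hom P A') : Prop :=
  forall (Z : C) (z : Hom Z A) (z' : Hom Z A'),
    exists! h : Hom Z P, p ∘ h = z /\ p' ∘ h = z'.

(* The square   P --q--> B
                |        |
                p        g
                v        v
                A --f--> D   *)
Definition is_pullback (C : Category) (A B D P : C)
    (f : Hom A D) (g : Hom B D) (p : Hom P A) (q : Hom P B) : Prop :=
  f ∘ p = g ∘ q /\
  forall (Z : C) (a : Hom Z A) (b : Hom Z B), f ∘ a = g ∘ b ->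
    exists! h : Hom Z P, p ∘ h = a /\ q ∘ h = b.

(* The square   D --g--> B
                |        |
                f        j
                v        v
                A --i--> P   *)
Definition is_pushout (C : Category) (D A B P : C)
    (f : Hom D A) (g : Hom D B) (i : Hom A P) (j : Hom B P) : Prop :=
  i ∘ f = j ∘ g /\
  forall (Z : C) (a : Hom A Z) (b : Hom B Z), a ∘ f = b ∘ g ->
    exists! h : Hom P Z, h ∘ i = a /\ h ∘ j = b.

Definition is_coequalizer (C : Category) (K X Q : C)
    (u v : Hom K X) (e : Hom X Q) : Prop :=
  e ∘ u = e ∘ v /\
  forall (Z : C) (z : Hom X Z), z ∘ u = z ∘ v ->
    exists! h : Hom Q Z, h ∘ e = z.

Definition is_kernel_pair (C : Category) (X Y K : C)
    (f : Hom X Y) (u v : Hom K X) : Prop :=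
  is_pullback f f u v.

Definition MorClass (C : Category) : Type := forall X Y : C, Hom X Y -> Prop.

Definition regular_epi (C : Category) : MorClass C :=
  fun X Y f => exists (K : C) (u v : Hom K X), is_coequalizer u v f.

Definition product_projection (C : Category) : MorClass C :=
  fun X A p => exists (A' : C) (p' : Hom X A'), is_product p p'.

Definition pullback_stable (C : Category) (M : MorClass C) : Prop :=
  forall (A B D P : C) (f : Hom A D) (g : Hom B D)
    (p : Hom P A) (q : Hom P B),
    is_pullback f g p q -> M B D g -> M P A p.

Definition regular_category (C : Category) : Prop :=
  has_finite_limits C /\
  (forall (X Y K : C) (f : Hom X Y) (u v : Hom K X), is_kernel_pair f u v ->
     exists (Q : C) (e : Hom X Q), is_coequalizer u v e) /\
  pullback_stable (@regular_epi C).

Definition global_support (C : Category) (X : C) : Prop :=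
  exists (T : C) (t : Hom X T), is_terminal T /\ regular_epi t.

Definition M_pushout (C : Category) (M : MorClass C) (D A B P : C)
    (f : Hom D A) (g : Hom D B) (i : Hom A P) (j : Hom B P) : Prop :=
  is_pushout f g i j /\ M A P i /\ M B P j.

Definition coextensive (C : Category) (M : MorClass C) (X : C) : Prop :=
  (forall (Y A : C) (f : Hom X Y) (p : Hom X A),
     M X Y f -> product_projection p ->
     exists (P : C) (i : Hom A P) (j : Hom Y P), M_pushout M p f i j) /\
  (* A1 <--p1-- X --p2--> A2
     |a1        |f        |a2
     v          v         v
     B1 <--q1-- Y --q2--> B2   *)
  (forall (A1 A2 B1 Y B2 : C)
     (p1 : Hom X A1) (p2 : Hom X A2) (q1 : Hom Y B1) (q2 : Hom Y B2)
     (a1 : Hom A1 B1) (f : Hom X Y) (a2 : Hom A2 B2),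
     is_product p1 p2 ->
     M A1 B1 a1 -> M X Y f -> M A2 B2 a2 ->
     a1 ∘ p1 = q1 ∘ f -> a2 ∘ p2 = q2 ∘ f ->
     (is_product q1 q2 <->
      M_pushout M p1 f a1 q1 /\ M_pushout M p2 f a2 q2)).

Definition regularly_coextensive (C : Category) (X : C) : Prop :=
  coextensive (@regular_epi C) X.

Definition projection_coextensive (C : Category) (X : C) : Prop :=
  coextensive (@product_projection C) X.

(* Main.v *)
(** Global support passes along any morphism, and a product projection [A × A' → A]
    is the pullback of [A' → 1] along [A → 1].  So every product projection out of an
    object that receives a morphism from [X] is a regular epimorphism, and regular
    coextensivity applies to all the diagrams in question.  The legs of the resulting
    pushouts are product projections because pushing out both legs of a product
    diagram along a regular epimorphism yields a product diagram. *)

From Stdlib Require Import FinFun List.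
Require Import Defs.

Set Implicit Arguments.
Unset Strict Implicit.
Unset Printing Implicit Defensive.

Local Open Scope cat_scope.

(** Limits over this category are binary products. Taking equality proofs as morphisms lets a
    functor act by transport. *)
Definition discrete_bool : Category.
Proof.
  refine (@MkCategory bool (fun i j => i = j) (fun i => eq_refl)
            (fun i j k v u => eq_trans u v) _ _ _).
  - intros i j u; destruct u; reflexivity.
  - intros i j u; destruct u; reflexivity.
  - intros i j k l w v u; destruct u, v, w; reflexivity.
Defined.

Lemma finite_discrete_bool : finite_category discrete_bool.
Proof.
  split.
  - exists (true :: false :: nil); intros [|]; simpl; auto.
  - intros i j; cbn.
    destruct (Bool.bool_dec i j) as [e | n].
    + subst j; exists (eq_refl :: nil); intros e; left.
      apply Eqdep_dec.UIP_dec; exact Bool.bool_dec.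
    + exists nil; intros e; contradiction.
Qed.

Definition pair_functor (C : Category) (A B : C) : Functor discrete_bool C.
Proof.
  refine (@MkFunctor discrete_bool C (fun i : bool => if i then A else B)
    (fun i j (u : i = j) =>
       match u in _ = j return
         Hom (if i then A else B) (if j then A else B)
       with eq_refl => idm _ end) _ _).
  - reflexivity.
  - intros i j k v u; cbn in *; destruct u, v; cbn; symmetry; apply comp_idl.
Defined.

Lemma finite_limits_product (C : Category) (A B : C) :
  has_finite_limits C ->
  exists (P : C) (p : Hom P A) (q : Hom P B), is_product p q.
Proof.
  intros HC.
  destruct (HC _ (pair_functor A B) finite_discrete_bool) as (L & pi & _ & U).
  exists L, (pi true), (pi false); intros Z z z'.
  destruct (U Z (fun i : bool => match i return Hom Z (if i then A else B) with
                                 | true => z | false => z' end))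
    as (h & Hh & Huniq).
  - intros i j u; cbn in *; destruct u, i; apply comp_idl.
  - exists h; split.
    + split; [exact (Hh true) | exact (Hh false)].
    + intros h' [E E']; apply Huniq; intros [|]; assumption.
Qed.

Lemma terminal_hom_eq (C : Category) (T Z : C) (f g : Hom Z T) :
  is_terminal T -> f = g.
Proof.
  intros HT; destruct (HT Z) as (t & _ & U).
  rewrite <- (U f I); exact (U g I).
Qed.

Lemma regular_epi_cancel (C : Category) (X Y Z : C) (e : Hom X Y)
    (f g : Hom Y Z) :
  regular_epi e -> f ∘ e = g ∘ e -> f = g.
Proof.
  intros (K & u & v & Heq & U) E.
  destruct (U Z (g ∘ e)) as (h & _ & Hu).
  - rewrite <- !comp_assoc, Heq; reflexivity.
  - rewrite <- (Hu f E); exact (Hu g eq_refl).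
Qed.

Lemma is_product_sym (C : Category) (A P B : C) (p : Hom P A) (q : Hom P B) :
  is_product p q -> is_product q p.
Proof.
  intros H Z z z'; destruct (H Z z' z) as (h & [E E'] & U).
  exists h; split; [split; assumption |].
  intros h' [F F']; apply U; split; assumption.
Qed.

Lemma is_pushout_sym (C : Category) (D A B P : C)
    (f : Hom D A) (g : Hom D B) (i : Hom A P) (j : Hom B P) :
  is_pushout f g i j -> is_pushout g f j i.
Proof.
  intros [E U]; split; [symmetry; exact E |].
  intros Z a b F; destruct (U Z b a (eq_sym F)) as (h & [G G'] & V).
  exists h; split; [split; assumption |].
  intros h' [K K']; apply V; split; assumption.
Qed.

Lemma product_pullback_over_terminal (C : Category) (T A P B : C)
    (a : Hom A T) (b : Hom B T) (p : Hom P A) (q : Hom P B) :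
  is_terminal T -> is_product p q -> is_pullback a b p q.
Proof.
  intros HT H; split; [apply terminal_hom_eq; exact HT |].
  intros Z z z' _; apply H.
Qed.

(** [A → 1] is the coequalizer of the two projections [A × A → A]: a [z] that identifies them is
    constant, and its value is obtained by descending [z ∘ f] along [X → 1]. *)
Lemma global_support_image (C : Category) (X A : C) (f : Hom X A) :
  regular_category C -> global_support X -> global_support A.
Proof.
  intros (Hlim & _ & Hstab) (T & t & HT & Ht).
  destruct (HT A) as (a & _ & _).
  exists T, a; split; [exact HT |].
  destruct (finite_limits_product A A Hlim) as (K & k1 & k2 & HK).
  destruct (finite_limits_product A X Hlim) as (P & pA & pX & HP).
  assert (HpA : regular_epi pA).
  { exact (Hstab _ _ _ _ _ _ _ _
             (product_pullback_over_terminal a t HT HP) Ht). }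
  exists K, k1, k2; split; [apply terminal_hom_eq; exact HT |].
  intros Z z Ez.
  (* Any [c] and [d] factor through [A × A] as a pair, so [z] cannot distinguish them. *)
  assert (Hz : forall (W : C) (c d : Hom W A), z ∘ c = z ∘ d).
  { intros W c d; destruct (HK W c d) as (h & [<- <-] & _).
    rewrite !comp_assoc, Ez; reflexivity. }
  destruct Ht as (K' & u & v & Et & Ut).
  destruct (Ut Z (z ∘ f)) as (k & Ek & _).
  { rewrite <- !comp_assoc; apply Hz. }
  exists k; split.
  - (* [z] and [k ∘ a] agree after the regular epimorphism [A × X → A]. *)
    apply (regular_epi_cancel HpA).
    rewrite <- comp_assoc, (terminal_hom_eq (a ∘ pA) (t ∘ pX) HT).
    rewrite comp_assoc, Ek, <- comp_assoc; apply Hz.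
  - intros k' Ek'; apply (regular_epi_cancel (e := t)).
    + exists K', u, v; split; assumption.
    + rewrite Ek, <- Ek', <- comp_assoc.
      f_equal; apply terminal_hom_eq; exact HT.
Qed.

Lemma projection_regular_epi (C : Category) (D A : C) (p : Hom D A) :
  regular_category C -> global_support D -> product_projection p ->
  regular_epi p.
Proof.
  intros HC HD (A' & p' & Hp).
  (* The support needed is that of the complementary factor, since [p] is a pullback of [A' → 1]. *)
  destruct (global_support_image p' HC HD) as (T & a' & HT & Ha').
  destruct (HT A) as (a & _ & _).
  destruct HC as (_ & _ & Hstab).
  exact (Hstab _ _ _ _ _ _ _ _
           (product_pullback_over_terminal a a' HT Hp) Ha').
Qed.

Lemma pushout_along_projection (C : Category) (X A Y P : C)
    (p : Hom X A) (f : Hom X Y) (i : Hom A P) (j : Hom Y P) :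
  regularly_coextensive X -> product_projection p -> regular_epi f ->
  M_pushout (@regular_epi C) p f i j -> product_projection j.
Proof.
  intros [Hpo Hprod] (A' & p' & Hp) Hf Hij.
  (* The complement of [j] is the leg [j'] obtained by pushing [f] out along the other projection
     [p']. *)
  destruct (Hpo Y A' f p' Hf) as (P' & i' & j' & Hij').
  { exists A, p; apply is_product_sym; exact Hp. }
  exists P', j'.
  destruct (Hprod A A' P Y P' p p' j j' i f i' Hp) as [_ H].
  - exact (proj1 (proj2 Hij)).
  - exact Hf.
  - exact (proj1 (proj2 Hij')).
  - exact (proj1 (proj1 Hij)).
  - exact (proj1 (proj1 Hij')).
  - exact (H (conj Hij Hij')).
Qed.

Theorem corollary7p1 (C : Category) (HC : regular_category C) (X : C)
    (HX : global_support X) :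
  regularly_coextensive X -> projection_coextensive X.
Proof.
  intros H; split.
  - intros Y A f p Hf Hp.
    assert (Rf := projection_regular_epi HC HX Hf).
    assert (Rp := projection_regular_epi HC HX Hp).
    destruct (proj1 H Y A f p Rf Hp) as (P & i & j & Hpo & Ri & Rj).
    exists P, i, j; repeat split; try apply Hpo.
    (* Both [f] and [p] are projections and regular epimorphisms, so the square may be transposed
       and their roles exchanged. *)
    + apply (pushout_along_projection (p := f) (f := p) (i := j) H Hf Rp).
      split; [apply is_pushout_sym; exact Hpo | split; assumption].
    + apply (pushout_along_projection (p := p) (f := f) (i := i) H Hp Rf).
      split; [exact Hpo | split; assumption].
  - intros A1 A2 B1 Y B2 p1 p2 q1 q2 a1 f a2 Hp Ha1 Hf Ha2 E1 E2.
    (* The morphism [d] witnesses that [D] inherits global support from [X]. *)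
    assert (R : forall (D B : C) (d : Hom X D) (b : Hom D B),
               product_projection b -> regular_epi b).
    { intros D B d b; apply projection_regular_epi; [exact HC |].
      exact (global_support_image d HC HX). }
    destruct (proj2 H A1 A2 B1 Y B2 p1 p2 q1 q2 a1 f a2 Hp
                (R _ _ p1 _ Ha1) (R _ _ (idm X) _ Hf) (R _ _ p2 _ Ha2) E1 E2)
      as [Hto Hfrom].
    split.
    + intros Hq; destruct (Hto Hq) as [[S1 _] [S2 _]].
      split; (split; [assumption | split; [assumption |]]).
      (* The legs [q1] and [q2] of the bottom product complement each other. *)
      * exists B2, q2; exact Hq.
      * exists B1, q1; apply is_product_sym; exact Hq.
    (* The projections [q1] and [q2] start at [Y], which receives [f] from [X]; hence they are
       regular epimorphisms and both squares are pushouts of the regular kind. *)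
    + intros [[S1 [_ Q1]] [S2 [_ Q2]]]; apply Hfrom.
      split; (split; [assumption | split]).
      * exact (R _ _ p1 _ Ha1).
      * exact (R _ _ f _ Q1).
      * exact (R _ _ p2 _ Ha2).
      * exact (R _ _ f _ Q2).
Qed.
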